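(* Let $\Psi:L_{0,1}\to H_\Pi=\bigoplus_{k\ge0}M_{2k+1}\otimes H_{\Pi_k}$ be a grading-preserving (for $\deg_H$ and $\deg_r$) unitary isomorphism of $\mathfrak{sl}_2$-modules, and endow each $H_{\Pi_k}$ with the structure of the Virasoro module $L(1,k^2)$ transported by $\Psi$. Then, for every $k\ge0$, the Gelfand--Tsetlin basis $\mathcal T_k$ of $H_{\Pi_k}$ (consisting of the infinite two-row Young tableaux tail-equivalent to $\tau_k$) is an eigenbasis of $L_0$, and the eigenvalues are given by the stable major index $r$: $$L_0\tau=r(\tau)\tau\qquad\text{for all }\tau\in\mathcal T_k.$$
   Context: Serpentine side. For $k\ge0$ let $\tau_k$ be the infinite two-row Young tableau with $1,2,\dots,2k,2k+1,2k+3,2k+5,\dots$ in the first row and $2k+2,2k+4,\dots$ in the second row. Two infinite standard two-row tableaux are tail-equivalent if, for all sufficiently large $l$, their parts formed by the entries $\le l$ have the same shape and the entries $>l$ lie in the same positions. $\mathcal T_k$ is the set of infinite standard two-row tableaux tail-equivalent to $\tau_k$, and $H_{\Pi_k}$ is the space with orthonormal basis $\mathcal T_k$; it carries the $k$-serpentine representation of $\mathfrak S_{\mathbb N}=\bigcup_N\mathfrak S_N$ (Young's orthogonal form). $H_\Pi=\bigoplus_{k\ge0}M_{2k+1}\otimes H_{\Pi_k}$, where $M_{2k+1}$ is the $(2k+1)$-dimensional irreducible (unitary) $\mathfrak{sl}_2$-module and $\mathfrak{sl}_2$ acts on the first factors. The major index of a standard tableau with $N$ cells is the sum of all $i\le N-1$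 such that $i+1$ lies in a lower row than $i$; the stable major index of $\tau\in\mathcal T_k$ is $r(\tau)=\lim_{n\to\infty}(n^2-\operatorname{maj}([\tau]_{2n}))$, where $[\tau]_l$ consists of the cells of $\tau$ with entries $\le l$. The grading $\deg_r$ is $\deg_r(u\otimes\tau)=r(\tau)$ for $u\in M_{2k+1}$, $\tau\in\mathcal T_k$. Affine side. $L_{0,1}$ is the basic module of $\widehat{\mathfrak{sl}_2}=\mathfrak{sl}_2\otimes\mathbb C[t,t^{-1}]\oplus\mathbb Cc\oplus\mathbb Cd$ (irreducible, level $1$, vacuum annihilated by $\mathfrak{sl}_2\otimes\mathbb C[t]$), with its standard invariant Hermitian inner product; $\mathfrak{sl}_2$ acts through $x\mapsto x\otimes1$; $\deg_H$ is the homogeneous grading, in which the vacuum has degree $0$ and $x\otimes t^{-m}$ raises the degree by $m$. Let $h$ be the Cartan generator ($[e,f]=h$), $h_n=h\otimes t^n$, $a_n=h_n/\sqrt2$, so $[a_m,a_n]=m\delta_{m+n,0}$. The Virasoro algebra acts on $L_{0,1}$ by $L_n=\frac12\sum_{j\in\mathbb Z}a_{-j}a_{j+n}$ for $n\ne0$ and $L_0=\frac12a_0^2+\sum_{j\ge1}a_{-j}a_j$. This action commutes with $\mathfrak{sl}_2$, so $\Psi L_m\Psi^{-1}$ acts on each $M_{2k+1}\otimes H_{\Pi_k}$ as $\mathrm{id}\otimes L_m^{(k)}$; the operators $L_m^{(k)}$ (written simply $L_m$ in the claim) define the transported Virasoro action on $H_{\Pi_k}$, which is isomorphic to $L(1,k^2)$,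 the irreducible Virasoro module with central charge $1$ and conformal dimension $k^2$. All spaces are algebraic (no completion). *)

(* Defs.v *)
(* The complex numbers are R[i] for an arbitrary R : realType. *)
From HB Require Import structures.
From mathcomp Require Import all_boot all_order all_algebra.
From mathcomp Require Import finmap.
From mathcomp Require Import all_classical all_reals all_analysis.
From mathcomp Require Import complex.
(* monalg declares a notation incompatible with MathComp-Analysis, hence the
   import of its contents without its notations. *)
From mathcomp.multinomials Require Import -(notations) monalg.

Set Implicit Arguments.
Unset Strict Implicit.
Unset Printing Implicit Defensive.

Import Order.TTheory GRing.Theory Num.Theory.
Import numFieldNormedType.Exports.

Local Open Scope classical_set_scope.
Local Open Scope ring_scope.

(** * Infinite two-row Young tableaux *)

(* A filling by all the positive integers is given by the positions of its
   entries: [t i] is the cell (row, column), both counted from 0, of the entry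
   i.+1.  Rows are listed from top to bottom. *)
Definition filling := nat -> nat * nat.

Definition standard_two_row (t : filling) : Prop :=
  [/\ injective t,
      forall i, ((t i).1 < 2)%N,
      (* the occupied cells form a Young diagram *)
      forall i a b, (a <= (t i).1)%N -> (b <= (t i).2)%N -> exists j, t j = (a, b),
      (* entries increase along rows *)
      forall i j, (t i).1 = (t j).1 -> ((t i).2 < (t j).2)%N -> (i < j)%N &
      (* entries increase down columns *)
      forall i j, (t i).2 = (t j).2 -> ((t i).1 < (t j).1)%N -> (i < j)%N].

(* The entries at most l are the i.+1 with (i < l)%N. *)
Definition tail_equivalent (t s : filling) : Prop :=
  exists l0 : nat, forall l : nat, (l0 <= l)%N ->
    t @` [set i | (i < l)%N] = s @` [set i | (i < l)%N] /\
    (forall i : nat, (l <= i)%N -> t i = s i).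

(* First row 1, 2, ..., 2k+1, 2k+3, 2k+5, ...; second row 2k+2, 2k+4, ... *)
Definition tau_ (k : nat) : filling := fun i =>
  if (i <= 2 * k)%N then (0, i)%N
  else if odd i then (1, (i - 2 * k)./2)%N
  else (0, 2 * k + (i - 2 * k)./2)%N.

Definition Tk (k : nat) : set filling :=
  [set t | standard_two_row t /\ tail_equivalent t (tau_ k)].

(* Major index of the part of [t] formed by the entries at most N. *)
Definition maj (t : filling) (N : nat) : nat :=
  (\sum_(1 <= i < N | (t i.-1).1 < (t i).1) i)%N.

Definition stable_maj (R : realType) (t : filling) : R :=
  lim ((fun n : nat => (n ^ 2)%:R - (maj t (2 * n))%:R : R) @ \oo).

Section LieModules.
Variable R : realType.
Local Notation C := R[i].

Definition is_subspace (V : lmodType C) (S : set V) : Prop :=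
  S 0 /\ forall (c : C) x y, S x -> S y -> S (c *: x + y).

Definition irreducible_under (V : lmodType C) (ops : set (V -> V)) : Prop :=
  (exists v : V, v != 0) /\
  forall S : set V, is_subspace S ->
    (forall X, ops X -> forall v, S v -> S (X v)) -> S = [set 0] \/ S = setT.

Definition comm_op (V : lmodType C) (X Y : V -> V) (v : V) : V :=
  X (Y v) - Y (X v).

Definition adjoint_for (V : lmodType C) (form : V -> V -> C) (X Y : V -> V) :=
  forall x y, form (X x) y = form x (Y y).

(** * The irreducible unitary sl2-modules M_n *)

(* An n-dimensional unitary space is modelled by row vectors with the standard
   inner product [dotmx], linear in its first argument. *)
Record unitary_irrep_sl2 (n : nat) := UnitaryIrrepSl2 {
  rep_e : {linear 'rV[C]_n -> 'rV[C]_n};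
  rep_f : {linear 'rV[C]_n -> 'rV[C]_n};
  rep_h : {linear 'rV[C]_n -> 'rV[C]_n};
  rep_ef : forall v, comm_op rep_e rep_f v = rep_h v;
  rep_he : forall v, comm_op rep_h rep_e v = 2 *: rep_e v;
  rep_hf : forall v, comm_op rep_h rep_f v = - 2 *: rep_f v;
  rep_irreducible : irreducible_under
    [set X : 'rV[C]_n -> 'rV[C]_n | [\/ X = rep_e, X = rep_f | X = rep_h]];
  rep_e_adj : adjoint_for (@dotmx C n) rep_e rep_f;
  rep_h_adj : adjoint_for (@dotmx C n) rep_h rep_h
}.

(** * The basic module of affine sl2 *)

(* [aff_e n] is the action of e (x) t^n, etc.; the invariant form of sl2 is
   the trace form, (e|f) = 1 and (h|h) = 2, and d acts as t d/dt. *)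
Record affine_sl2_module (W : lmodType C) := AffineSl2Module {
  aff_e : int -> {linear W -> W};
  aff_f : int -> {linear W -> W};
  aff_h : int -> {linear W -> W};
  aff_c : {linear W -> W};
  aff_d : {linear W -> W};
  aff_ee : forall m n w, comm_op (aff_e m) (aff_e n) w = 0;
  aff_ff : forall m n w, comm_op (aff_f m) (aff_f n) w = 0;
  aff_ef : forall m n w, comm_op (aff_e m) (aff_f n) w =
    aff_h (m + n) w + (if m + n == 0 then m%:~R *: aff_c w else 0);
  aff_he : forall m n w, comm_op (aff_h m) (aff_e n) w = 2 *: aff_e (m + n) w;
  aff_hf : forall m n w, comm_op (aff_h m) (aff_f n) w = - 2 *: aff_f (m + n) w;
  aff_hh : forall m n w, comm_op (aff_h m) (aff_h n) w =
    if m + n == 0 then (2 * m)%:~R *: aff_c w else 0;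
  aff_ce : forall n w, comm_op aff_c (aff_e n) w = 0;
  aff_cf : forall n w, comm_op aff_c (aff_f n) w = 0;
  aff_ch : forall n w, comm_op aff_c (aff_h n) w = 0;
  aff_cd : forall w, comm_op aff_c aff_d w = 0;
  aff_de : forall n w, comm_op aff_d (aff_e n) w = n%:~R *: aff_e n w;
  aff_df : forall n w, comm_op aff_d (aff_f n) w = n%:~R *: aff_f n w;
  aff_dh : forall n w, comm_op aff_d (aff_h n) w = n%:~R *: aff_h n w
}.

Record basic_module (W : lmodType C) := BasicModule {
  bas_act :> affine_sl2_module W;
  bas_irreducible : irreducible_under
    [set X : W -> W | (exists n, [\/ X = aff_e bas_act n, X = aff_f bas_act n
                                   | X = aff_h bas_act n])
                      \/ X = aff_c bas_act \/ X = aff_d bas_act];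
  bas_level1 : forall w, aff_c bas_act w = w;
  vac : W;
  vac_neq0 : vac != 0;
  vac_e : forall n : int, 0 <= n -> aff_e bas_act n vac = 0;
  vac_f : forall n : int, 0 <= n -> aff_f bas_act n vac = 0;
  vac_h : forall n : int, 0 <= n -> aff_h bas_act n vac = 0;
  vac_d : aff_d bas_act vac = 0;
  bas_form : {dot W for Num.conj};
  bas_form_vac : bas_form vac vac = 1;
  bas_e_adj : forall n, adjoint_for bas_form (aff_e bas_act n) (aff_f bas_act (- n));
  bas_h_adj : forall n, adjoint_for bas_form (aff_h bas_act n) (aff_h bas_act (- n));
  bas_d_adj : adjoint_for bas_form (aff_d bas_act) (aff_d bas_act)
}.

(* The homogeneous grading is by the eigenvalues of -d: the vacuum has degree 0
   and x (x) t^-m raises the degree by m. *)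
Definition deg_H (W : lmodType C) (B : basic_module W) (n : int) (w : W) : Prop :=
  aff_d B w = - n%:~R *: w.

Definition heis (W : lmodType C) (B : affine_sl2_module W) (n : int) (w : W) : W :=
  (sqrtC 2)^-1 *: aff_h B n w.

(* On the basic module only finitely many terms of these sums are nonzero at a
   given vector; [\sum_(j \in A)] is the sum over the finite support. *)
Definition virasoro (W : lmodType C) (B : affine_sl2_module W) (n : int) (w : W) : W :=
  let a := heis B in
  if n == 0
  then 2^-1 *: a 0 (a 0 w) + \sum_(j \in [set j : int | 1 <= j]) a (- j) (a j w)
  else 2^-1 *: \sum_(j \in [set: int]) a (- j) (a (j + n) w).

(** * The space H_Pi *)

(* [malg K C] is the space of finite linear combinations of elements of K. *)
Definition HPik (k : nat) := malg (Tk k) C.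

(* H_Pi is modelled by its orthonormal basis (k, (i, t)), which stands for the
   tensor product of the i-th standard vector of M_(2k+1) with the tableau t. *)
Definition HPi_index := {k : nat & ('I_(2 * k).+1 * Tk k)%type}.
Definition HPi := malg HPi_index C.

Definition basis_vec (K : choiceType) (x : K) : malg K C := mkmalgU x 1.

Definition HPi_key (k : nat) (i : 'I_(2 * k).+1) (t : Tk k) : HPi_index :=
  existT (fun k => ('I_(2 * k).+1 * Tk k)%type) k (i, t).

Definition tens (k : nat) (u : 'rV[C]_(2 * k).+1) (v : HPik k) : HPi :=
  \sum_i \sum_(t <- msupp v)
    (u 0 i * mcoeff t v) *: basis_vec (HPi_key i t).

Definition HPi_form (x y : HPi) : C :=
  \sum_(b <- msupp x) mcoeff b x * (mcoeff b y)^*.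

(* X acting on the first tensor factors. *)
Definition on_first (X : forall k, 'rV[C]_(2 * k).+1 -> 'rV[C]_(2 * k).+1)
    (x : HPi) : HPi :=
  \sum_(b <- msupp x)
    mcoeff b x *: tens (X (tag b) (delta_mx 0 (tagged b).1)) (basis_vec (tagged b).2).

Definition deg_r (n : int) (x : HPi) : Prop :=
  forall b : HPi_index, mcoeff b x != 0 ->
    stable_maj R (val (tagged b).2) = n%:~R.

(** * The isomorphism and the transported Virasoro operators *)

Record graded_unitary_iso (W : lmodType C) (B : basic_module W)
    (M : forall k, unitary_irrep_sl2 (2 * k).+1) := GradedUnitaryIso {
  iso :> {linear W -> HPi};
  iso_inv : HPi -> W;
  isoK : cancel iso iso_inv;
  iso_invK : cancel iso_inv iso;
  iso_unitary : forall x y, HPi_form (iso x) (iso y) = bas_form B x y;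
  iso_e : forall w, iso (aff_e B 0 w) = on_first (fun k => rep_e (M k)) (iso w);
  iso_f : forall w, iso (aff_f B 0 w) = on_first (fun k => rep_f (M k)) (iso w);
  iso_h : forall w, iso (aff_h B 0 w) = on_first (fun k => rep_h (M k)) (iso w);
  iso_graded : forall n w, deg_H B n w <-> deg_r n (iso w)
}.

(* The operator T on H_(Pi_k) such that Psi L_m Psi^-1 acts on
   M_(2k+1) (x) H_(Pi_k) as id (x) T.  There is at most one such T, because
   M_(2k+1) is nonzero; the default value 0 is taken only if there is none. *)
Definition transported_virasoro (W : lmodType C) (B : basic_module W)
    (M : forall k, unitary_irrep_sl2 (2 * k).+1) (Psi : graded_unitary_iso B M)
    (k : nat) (m : int) : HPik k -> HPik k :=
  xget (fun=> 0) [set T : HPik k -> HPik k |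
    forall u v, Psi (virasoro B m (iso_inv Psi (tens u v))) = tens u (T v)].

End LieModules.

(* Main.v *)
Require Import Defs.
From HB Require Import structures.
From mathcomp Require Import all_boot all_order all_algebra.
From mathcomp Require Import finmap.
From mathcomp Require Import all_classical all_reals all_analysis.
From mathcomp Require Import complex.
From mathcomp.multinomials Require Import -(notations) monalg.
From mathcomp Require Import zify ring.

Set Implicit Arguments.
Unset Strict Implicit.
Unset Printing Implicit Defensive.

Import Order.TTheory GRing.Theory Num.Theory.
Import numFieldNormedType.Exports.

Local Open Scope ring_scope.

(** The assertion reduces to the identity L_0 = -d on the basic module.  Indeed
    Psi matches deg_H, the grading by eigenvalues of -d, with deg_r, so once
    L_0 = -d is known the transported L_0 multiplies every u (x) tau by
    r(tau), provided r(tau) is an integer degree; and it is one because adding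
    the entries 2n+1, 2n+2 to a tableau of T_k with n large adds exactly one
    descent, at 2n+1 = (n+1)^2 - n^2, so that n^2 - maj is eventually constant
    ([stable_maj_int]).

    For L_0 = -d, let E_n = sum_i e_i e_(n-i) be the modes of e(z)^2 ([esq]).
    At level 1 these operators vanish ([esq_eq0]): the commutator [f_m, E_n]
    depends on m + n only ([comm_f_esq0]), so the vectors w such that every
    f_0^s w is annihilated by all E_n form a submodule; it contains the vacuum
    because E_n vac is orthogonal to itself ([esq_vac]); by irreducibility it
    is everything.  Commuting E_n = 0 with f_0 gives the relation
    :h(z)e(z): = e'(z) in modes ([nprod_eq]).  The commutator [L_0, e_n] of the
    Heisenberg operator L_0 is a mode of :h(z)e(z): up to a correction, and the
    relation turns it into -n e_n ([virasoro0_e]).  Hence D = L_0 + d commutes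
    with all e_n; being self-adjoint for the invariant form it commutes with
    their adjoints f_(-n), thus with the whole affine algebra; since it kills
    the vacuum, it is 0 ([virasoro0_eq]). *)

(** * Finitely supported sums over the integers *)

Section IntSums.
Variable V : zmodType.
Implicit Types (F : int -> V) (a : int) (L A : nat).

Lemma fsbig_window (D : set int) F a L :
  (forall i, D i -> F i != 0 -> a <= i < a + L%:Z) ->
  (forall i, a <= i < a + L%:Z -> D i) ->
  \sum_(i \in D) F i = \sum_(k < L) F (a + k%:Z).
Proof.
move=> DF FD; pose W := [set i : int | a <= i < a + L%:Z]%classic.
rewrite -(@fsbig_widen _ _ _ _ W D F) => [|i /= Wi|i [/= Di nWi]]; first last.
- by apply: contra_notP nWi => /eqP Fi; exact: DF.
- exact: FD.
rewrite (fsbig_ord _ L (fun k => F (a + k%:Z))).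
apply: (reindex_fsbig (fun k : nat => a + k%:Z)); split.
- by move=> k /= kL; rewrite /W /=; lia.
- by move=> k l _ _ /= /addrI [].
- move=> i; rewrite /W /= => Wi; exists `|i - a|%N; lia.
Qed.

Lemma sum_reflect F A :
  \sum_(k < (2 * A).+1) F (- A%:Z + k%:Z) =
  F 0 + \sum_(k < A) (F (1 + k%:Z) + F (- (1 + k%:Z))).
Proof.
elim: A => [|A IH]; first by rewrite !big_ord1 big_ord0 addr0 addr0.
rewrite mulnS add2n big_ord_recr big_ord_recl /= [in RHS]big_ord_recr /=.
under eq_bigr => i _.
  rewrite (_ : - A.+1%:Z + bump 0 i = - A%:Z + i%:Z); last by rewrite /bump; lia.
  over.
rewrite IH addr0 !addrA.
rewrite (_ : - A.+1%:Z + (2 * A).+2%:Z = 1 + A%:Z); last by lia.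
rewrite (_ : - A.+1%:Z = - (1 + A%:Z)); last by lia.
rewrite -!addrA addrC -!addrA; congr (_ + (_ + _)).
Qed.

End IntSums.

(** * The basic module *)

Section BasicModule.
Variables (R : realType) (W : lmodType R[i]) (B : basic_module W).
Local Notation C := R[i].
Local Notation e := (aff_e B).
Local Notation f := (aff_f B).
Local Notation h := (aff_h B).
Local Notation d := (aff_d B).
Local Notation vac := (vac B).
Local Notation form := (bas_form B).
Implicit Types (u v w : W) (m n j : int).

Lemma comm_ee m n w : e m (e n w) = e n (e m w).
Proof. by apply/eqP; rewrite -subr_eq0; apply/eqP; exact: aff_ee. Qed.

Lemma comm_ff m n w : f m (f n w) = f n (f m w).
Proof. by apply/eqP; rewrite -subr_eq0; apply/eqP; exact: aff_ff. Qed.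

Lemma comm_ef m n w :
  e m (f n w) = f n (e m w) + (h (m + n) w + (m *+ (m + n == 0))%:~R *: w).
Proof.
have := aff_ef B m n w; rewrite /comm_op => /eqP; rewrite subr_eq addrC => /eqP ->.
congr (_ + (_ + _)); rewrite bas_level1.
by case: eqP => _; rewrite ?mulr1n // mulr0n scale0r.
Qed.

Lemma comm_he m n w : h m (e n w) = e n (h m w) + 2 *: e (m + n) w.
Proof.
by have /eqP := aff_he B m n w; rewrite /comm_op subr_eq addrC => /eqP ->.
Qed.

Lemma comm_hf m n w : h m (f n w) = f n (h m w) - 2 *: f (m + n) w.
Proof.
by have /eqP := aff_hf B m n w; rewrite /comm_op subr_eq scaleNr addrC => /eqP ->.
Qed.

Lemma comm_hh m n w :
  h m (h n w) = h n (h m w) + ((2 * m) *+ (m + n == 0))%:~R *: w.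
Proof.
have /eqP := aff_hh B m n w; rewrite /comm_op subr_eq addrC => /eqP ->.
rewrite bas_level1.
by case: eqP => _; rewrite ?mulr1n // mulr0n scale0r.
Qed.

Lemma comm_de n w : d (e n w) = e n (d w) + n%:~R *: e n w.
Proof.
by have /eqP := aff_de B n w; rewrite /comm_op subr_eq addrC => /eqP ->.
Qed.

Lemma comm_df n w : d (f n w) = f n (d w) + n%:~R *: f n w.
Proof.
by have /eqP := aff_df B n w; rewrite /comm_op subr_eq addrC => /eqP ->.
Qed.

Lemma comm_dh n w : d (h n w) = h n (d w) + n%:~R *: h n w.
Proof.
by have /eqP := aff_dh B n w; rewrite /comm_op subr_eq addrC => /eqP ->.
Qed.

(** Irreducibility as an induction principle; at level 1 the central element is
    the identity, so every subspace is stable under it. *)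
Lemma basic_ind (S : set W) :
  is_subspace S -> S vac ->
  (forall n w, S w -> S (e n w)) -> (forall n w, S w -> S (f n w)) ->
  (forall n w, S w -> S (h n w)) -> (forall w, S w -> S (d w)) ->
  forall w, S w.
Proof.
move=> subS Svac Se Sf Sh Sd.
have [|S0|-> //] := (bas_irreducible B).2 S subS.
  move=> X [[n [] -> w]|[] -> w]; [exact: Se|exact: Sf|exact: Sh| |exact: Sd].
  by rewrite bas_level1.
by move: Svac (vac_neq0 B); rewrite S0 => ->; rewrite eqxx.
Qed.

(** * Local finiteness *)

Definition killed_above (N : nat) (w : W) : Prop :=
  forall j, N%:Z < j -> [/\ e j w = 0, f j w = 0 & h j w = 0].

Lemma killed_above_le N P w : (N <= P)%N -> killed_above N w -> killed_above P w.
Proof. by move=> NP kw j Pj; apply: kw; lia. Qed.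

Lemma killed_above_ex w : exists N, killed_above N w.
Proof.
apply: (basic_ind (S := fun w => exists N, killed_above N w)) w.
- split=> [|c x y [Nx kx] [Ny ky]]; first by exists 0%N => j _; rewrite !linear0.
  exists (maxn Nx Ny) => j Nj.
  have [|ex fx hx] := kx j; first by lia.
  have [|ey fy hy] := ky j; first by lia.
  by rewrite !linearP ex fx hx ey fy hy scaler0 addr0.
- by exists 0%N => j j0; rewrite vac_e ?vac_f ?vac_h //; lia.
- move=> n w [N kw]; exists (N + `|n|)%N => j Nj.
  have [|ej fj hj] := kw j; first by lia.
  have [|ejn _ hjn] := kw (j + n); first by lia.
  rewrite comm_ee ej linear0 comm_he hj ejn linear0 scaler0 addr0; split=> //.
  have := comm_ef n j w; rewrite fj linear0 addrC [n + j]addrC hjn => /esym.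
  have -> : (j + n == 0) = false by lia.
  by rewrite mulr0n scale0r !add0r.
- move=> n w [N kw]; exists (N + `|n|)%N => j Nj.
  have [|ej fj hj] := kw j; first by lia.
  have [|_ fjn hjn] := kw (j + n); first by lia.
  rewrite comm_ff fj linear0 comm_hf hj fjn linear0 scaler0 subr0; split=> //.
  rewrite comm_ef ej hjn linear0 !add0r.
  have -> : (j + n == 0) = false by lia.
  by rewrite mulr0n scale0r.
- move=> n w [N kw]; exists (N + `|n|)%N => j Nj.
  have [|ej fj hj] := kw j; first by lia.
  have [|ejn fjn hjn] := kw (n + j); first by lia.
  have := comm_he n j w; rewrite ej ejn linear0 scaler0 addr0 => <-.
  have := comm_hf n j w; rewrite fj fjn linear0 scaler0 subr0 => <-.
  rewrite comm_hh hj linear0 add0r.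
  have -> : (j + n == 0) = false by lia.
  by rewrite mulr0n scale0r.
- move=> w [N kw]; exists N => j Nj.
  have [ej fj hj] := kw j Nj.
  have := comm_de j w; rewrite ej linear0 scaler0 addr0 => <-.
  have := comm_df j w; rewrite fj linear0 scaler0 addr0 => <-.
  by have := comm_dh j w; rewrite hj linear0 scaler0 addr0 => <-.
Qed.

(** * The square of the current e(z) *)

Definition esq (n : int) (w : W) : W := \sum_(i \in [set: int]) e i (e (n - i) w).

(** The e_i commute, so a term with i > N or n - i > N dies on [w]; this bounds
    the sum on both sides, and any window containing [n - N, N] computes it. *)
Lemma esq_window n w N a (L : nat) : killed_above N w ->
  a <= n - N%:Z -> N%:Z < a + L%:Z ->
  esq n w = \sum_(k < L) e (a + k%:Z) (e (n - (a + k%:Z)) w).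
Proof.
move=> kw aN NL; apply: (fsbig_window (F := fun i => e i (e (n - i) w))) => // i _.
apply: contra_neqT; rewrite negb_and -!ltNge => /orP[ia|iL].
  by have [|-> _ _] := kw (n - i); rewrite ?linear0 //; lia.
by rewrite comm_ee; have [|-> _ _] := kw i; rewrite ?linear0 //; lia.
Qed.

Lemma killed_above_ex2 u v : exists N, killed_above N u /\ killed_above N v.
Proof.
have [N ku] := killed_above_ex u; have [P kv] := killed_above_ex v.
by exists (maxn N P); split; [apply: killed_above_le ku | apply: killed_above_le kv];
  lia.
Qed.

Lemma esq_subspace n : is_subspace [set w | esq n w = 0]%classic.
Proof.
split=> [|c x y /=].
  by apply: fsbig1 => i _; rewrite !linear0.
have [N [kx ky]] := killed_above_ex2 x y.
have kxy : killed_above N (c *: x + y).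
  move=> j Nj; have [ex fx hx] := kx j Nj; have [ey fy hy] := ky j Nj.
  by rewrite !linearP ex fx hx ey fy hy scaler0 addr0.
pose A := (N + `|n|)%N.
rewrite (@esq_window n x N (- A%:Z) (2 * A).+1) //; try lia.
rewrite (@esq_window n y N (- A%:Z) (2 * A).+1) //; try lia.
rewrite (@esq_window n _ N (- A%:Z) (2 * A).+1 kxy); try lia.
move=> x0 y0; under eq_bigr => i _ do rewrite !linearP.
by rewrite big_split -scaler_sumr /= x0 y0 scaler0 addr0.
Qed.

Lemma comm_e_esq m n w : e m (esq n w) = esq n (e m w).
Proof.
have [N [kw kew]] := killed_above_ex2 w (e m w).
pose A := (N + `|n|)%N.
rewrite !(@esq_window n _ N (- A%:Z) (2 * A).+1) //; try lia.
rewrite linear_sum; apply: eq_bigr => i _ /=.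
by rewrite comm_ee; congr (e _ _); rewrite comm_ee.
Qed.

Lemma comm_d_esq n w : d (esq n w) = esq n (d w) + n%:~R *: esq n w.
Proof.
have [N [kw kdw]] := killed_above_ex2 w (d w).
pose A := (N + `|n|)%N.
rewrite !(@esq_window n _ N (- A%:Z) (2 * A).+1) //; try lia.
rewrite linear_sum scaler_sumr -big_split; apply: eq_bigr => i _ /=.
rewrite comm_de comm_de linearD linearZ -addrA -scalerDl -intrD.
by congr (_ + _%:~R *: _); lia.
Qed.

Lemma comm_h_esq m n w : h m (esq n w) = esq n (h m w) + 4 *: esq (n + m) w.
Proof.
have [N [kw khw]] := killed_above_ex2 w (h m w).
pose A := (N + `|n| + `|m|)%N.
rewrite !(@esq_window n _ N (- A%:Z) (2 * A).+1) //; try lia.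
rewrite linear_sum (_ : 4 = 2 + 2) 1?scalerDl; last by ring.
rewrite {1}(@esq_window (n + m) _ N (- A%:Z) (2 * A).+1) //; try lia.
rewrite (@esq_window (n + m) _ N (- A%:Z + m) (2 * A).+1) //; try lia.
rewrite !scaler_sumr -!big_split; apply: eq_bigr => i _ /=.
rewrite comm_he comm_he linearD linearZ -addrA.
by congr (_ + (2 *: e _ (e _ _) + 2 *: e _ (e _ _))); lia.
Qed.

(** The normally ordered product :h(z)e(z):, with the modes h_j, j >= 0,
    placed on the right. *)
Definition nprod_term n w j : W :=
  if j < 0 then h j (e (n - j) w) else e (n - j) (h j w).

Definition nprod n w : W := \sum_(j \in [set: int]) nprod_term n w j.

Lemma nprod_window n w N a (L : nat) : killed_above N w ->
  a <= n - N%:Z -> a <= 0 -> N%:Z < a + L%:Z ->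
  nprod n w = \sum_(k < L) nprod_term n w (a + k%:Z).
Proof.
move=> kw aN a0 NL; apply: fsbig_window => // i _.
apply: contra_neqT; rewrite negb_and -!ltNge /nprod_term => /orP[ia|iL].
  have -> : i < 0 by lia.
  by have [|-> _ _] := kw (n - i); rewrite ?linear0 //; lia.
have -> : (i < 0) = false by lia.
by have [|_ _ ->] := kw i; rewrite ?linear0 //; lia.
Qed.

(** Reordering the finitely many modes h_j, j < 0, of a window starting at [a]
    costs one commutator [e_(n-j), h_j] = -2 e_n for each of them. *)
Lemma sum_eh_window n w N a (L : nat) : killed_above N w ->
  a <= n - N%:Z -> a <= 0 -> N%:Z < a + L%:Z ->
  \sum_(k < L) e (n - (a + k%:Z)) (h (a + k%:Z) w) =
  nprod n w + (2 * a)%:~R *: e n w.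
Proof.
move=> kw aN a0 NL; rewrite (@nprod_window n w N a L) //.
(* the terms with j < 0 are the first A of the window *)
pose A := `|a|%N; have aA : a = - A%:Z by rewrite /A; lia.
have -> : \sum_(k < L) nprod_term n w (a + k%:Z) =
    \sum_(k < L) e (n - (a + k%:Z)) (h (a + k%:Z) w) +
    \sum_(k < L | (k < A)%N) 2 *: e n w.
  rewrite [X in _ + X]big_mkcond -big_split; apply: eq_bigr => k _ /=.
  rewrite /nprod_term; have -> : (a + k%:Z < 0) = (k < A)%N by lia.
  case: ifP => _; last by rewrite addr0.
  by rewrite comm_he; congr (_ + _ *: e _ _); lia.
rewrite -(big_ord_widen L (fun=> 2 *: e n w)); last by lia.
rewrite sumr_const card_ord -scaler_nat scalerA -addrA -scalerDl.
suff -> : A%:R * 2 + (2 * a)%:~R = 0 :> C by rewrite scale0r addr0.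
by rewrite aA; ring.
Qed.

Lemma comm_fe m n w :
  f m (e n w) = e n (f m w) - h (m + n) w + (m *+ (m + n == 0))%:~R *: w.
Proof.
have -> : (m *+ (m + n == 0))%:~R *: w = - ((n *+ (m + n == 0))%:~R *: w).
  rewrite -scaleNr -mulrNz; congr (_%:~R *: _).
  by case: eqP => ?; lia.
by rewrite comm_ef [n + m]addrC [h _ w + _]addrC addrA !addrK.
Qed.

(** The right-hand side depends on [m] and [n] through [n + m] only, except for
    [esq n (f m w)]; this is where the level being 1 matters: at level c the
    central terms contribute 2 c m, and only for c = 1 do they compensate the
    m-dependence of the reordering terms. *)
Lemma comm_f_esq m n w :
  f m (esq n w) = esq n (f m w)
    - (2 *: nprod (n + m) w + (2 * (n + m + 1))%:~R *: e (n + m) w).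
Proof.
have [N [kw kfw]] := killed_above_ex2 w (f m w).
pose A := (N + `|n| + `|m|)%N; pose L := (2 * A).+1; pose a := - A%:Z.
rewrite !(@esq_window n _ N a L) //; try lia.
have term i : f m (e i (e (n - i) w)) = e i (e (n - i) (f m w))
   - e (n + m - (m + i)) (h (m + i) w) - 2 *: e (n + m) w - e i (h (n + m - i) w)
   + (m *+ (i == - m))%:~R *: e (n + m) w
   + (m *+ (i == n + m))%:~R *: e (n + m) w.
  rewrite comm_fe comm_fe comm_he linearD linearB linearZ /=.
  rewrite (_ : m + (n - i) = n + m - i); last by ring.
  rewrite (_ : n + m - (m + i) = n - i); last by ring.
  rewrite (_ : m + i + (n - i) = n + m); last by ring.
  have -> : (m *+ (n + m - i == 0))%:~R *: e i w =
            (m *+ (i == n + m))%:~R *: e (n + m) w.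
    rewrite subr_eq0 eq_sym; case: eqP => [->//|_]; by rewrite !mulr0n !scale0r.
  have -> : (m *+ (m + i == 0))%:~R *: e (n - i) w =
            (m *+ (i == - m))%:~R *: e (n + m) w.
    rewrite addrC addr_eq0; case: eqP => [->|_]; first by rewrite opprK.
    by rewrite !mulr0n !scale0r.
  by rewrite opprD !addrA [LHS](ACl (1*4*5*2*6*3)).
have delta j : a <= j < a + L%:Z ->
    \sum_(k < L) (m *+ (a + k%:Z == j))%:~R *: e (n + m) w =
    m%:~R *: e (n + m) w.
  move=> aj; have kL : (`|j - a| < L)%N by lia.
  rewrite (bigD1 (Ordinal kL)) //= big1 ?addr0 => [|k kj].
    by rewrite (_ : a + `|j - a|%N = j) ?eqxx ?mulr1n //; lia.
  rewrite (_ : (a + k%:Z == j) = false) ?mulr0n ?scale0r //.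
  by apply: contra_neqF kj => /eqP kj; apply: val_inj => /=; lia.
have eh1 : \sum_(k < L) e (n + m - (m + (a + k%:Z))) (h (m + (a + k%:Z)) w) =
    nprod (n + m) w + (2 * (m + a))%:~R *: e (n + m) w.
  under eq_bigr => k _ do rewrite addrA.
  by apply: (sum_eh_window kw); lia.
have eh2 : \sum_(k < L) e (a + k%:Z) (h (n + m - (a + k%:Z)) w) =
    nprod (n + m) w + (2 * (n + m + a))%:~R *: e (n + m) w.
  rewrite -(@sum_eh_window _ _ N (n + m + a) L) //; try lia.
  rewrite (reindex_inj rev_ord_inj) /=; apply: eq_bigr => k _.
  by congr (e _ (h _ _)); have := ltn_ord k; lia.
rewrite linear_sum; under eq_bigr => k _ do rewrite /= term.
rewrite !big_split /= !sumrN eh1 eh2 !delta; try lia.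
rewrite sumr_const card_ord -scaler_nat.
set E := e (n + m) w; set P := nprod (n + m) w.
rewrite !opprD !addrA [LHS](ACl (1*(2*5)*(3*4*6*7*8))).
rewrite -[LHS]addrA -[RHS]addrA; congr (_ + (_ + _)).
  by rewrite scaler_nat mulr2n opprD.
rewrite /= -!scaleNr scalerA -!scalerDl; congr (_ *: _).
by rewrite /L /a; ring.
Qed.

Lemma form_conj u v : form u v = (form v u)^*.
Proof. by rewrite hermC /= expr0 mul1r. Qed.

Lemma adj_e n u v : form (e n u) v = form u (f (- n) v).
Proof. exact: bas_e_adj. Qed.

Lemma adj_f n u v : form (f n u) v = form u (e (- n) v).
Proof. by rewrite form_conj [RHS]form_conj adj_e opprK. Qed.

Lemma adj_h n u v : form (h n u) v = form u (h (- n) v).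
Proof. exact: bas_h_adj. Qed.

(** Hence the E_n together with their iterated brackets with f_0 are closed
    under brackets with every f_m. *)
Lemma comm_f_esq0 m n w :
  f m (esq n w) - esq n (f m w) = f 0 (esq (n + m) w) - esq (n + m) (f 0 w).
Proof. by rewrite !comm_f_esq addr0 [LHS]addrAC [RHS]addrAC !subrr !add0r. Qed.

(** By downward induction on [n], starting where every term of the sum has a
    nonnegative mode: by [comm_f_esq0] and the vanishing for larger n, the
    vector v = E_n vac is killed by all f_m with m >= 1.  As v is a sum of
    e_i e_(n-i) vac with i < 0, and e_i is adjoint to f_(-i), the vector v is
    orthogonal to itself. *)
Lemma esq_vac n : esq n vac = 0.
Proof.
have [p] : exists p, -1 - Posz p <= n by exists `|n|%N; lia.
elim: p n => [|p IH] n np.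
  apply: fsbig1 => i _; have [i0|i0] := leP 0 i.
    by rewrite comm_ee vac_e ?linear0.
  by rewrite [e (n - i) _]vac_e ?linear0 //; lia.
have [/IH //|n2] := leP (-1 - Posz p) n.
have fv m : 1 <= m -> f m (esq n vac) = 0.
  move=> m1; have := comm_f_esq0 m n vac.
  rewrite [esq (n + m) vac]IH ?[f m vac]vac_f ?[f 0 vac]vac_f //; try lia.
  have esq00 q : esq q 0 = 0 := (esq_subspace q).1.
  by rewrite !esq00 !linear0 !addr0.
apply/eqP; rewrite -(dnorm_eq0 form); apply/eqP.
have [N kvac] := killed_above_ex vac; pose A := (N + `|n|)%N.
rewrite {1}(@esq_window n vac N (- A%:Z) (2 * A).+1) //; try lia.
rewrite linear_sumlz big1 //= => k _; set i := _ + _%:Z.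
have [i0|i0] := leP 0 i; first by rewrite comm_ee [e i _]vac_e // linear0 linear0l.
by rewrite adj_e fv ?linear0r //; lia.
Qed.

Lemma virasoro0_window w N A : killed_above N w -> (N <= A)%N ->
  virasoro B 0 w = 4^-1 *: h 0 (h 0 w) +
    \sum_(k < A) 2^-1 *: h (- (1 + k%:Z)) (h (1 + k%:Z) w).
Proof.
move=> kw NA.
have half (u : W) : (sqrtC 2)^-1 *: ((sqrtC 2)^-1 *: u) = 2^-1 *: u :> W.
  by rewrite scalerA -invfM -expr2 sqrtCK.
rewrite /virasoro eqxx /heis /= [h 0 (_ *: _)]linearZ /= half scalerA -invfM.
rewrite (_ : 2 * 2 = 4 :> C); last by ring.
congr (_ + _).
rewrite (@fsbig_window _ [set j : int | 1 <= j]%classic _ 1 A).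
- by apply: eq_bigr => k _; rewrite [h (- _) _]linearZ half.
- move=> j /= j1; apply: contra_neqT; rewrite negb_and -!ltNge => /orP[|jA]; first by lia.
  by have [|_ _ ->] := kw j; rewrite ?scaler0 ?linear0 ?scaler0 //; lia.
- by move=> j /=; lia.
Qed.

(** The central term n delta_(n,0) c of [e_n, f_0] is always 0. *)
Lemma h_of_ef n w : h n w = e n (f 0 w) - f 0 (e n w).
Proof.
rewrite comm_ef addr0 addrC addKr.
by case: eqP => [->|_]; rewrite ?mul0rn ?mulr0n scale0r addr0.
Qed.

(** The kernel K0 of all the E_n is stable under e_m, h_m and d, but f_m maps
    w into K0 only if f_0 w lies there as well.  Hence the passage to K, the
    vectors whose whole f_0-orbit lies in K0, which is a submodule. *)
Lemma esq_eq0 n w : esq n w = 0.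
Proof.
pose K0 (u : W) := forall n, esq n u = 0.
have K0lin : is_subspace K0.
  split=> [q|c x y Kx Ky q]; first exact: (esq_subspace q).1.
  exact: (esq_subspace q).2.
have K0e m u : K0 u -> K0 (e m u).
  by move=> Ku q; rewrite -comm_e_esq Ku linear0.
have K0h m u : K0 u -> K0 (h m u).
  move=> Ku q; have := comm_h_esq m q u.
  by rewrite !Ku linear0 scaler0 addr0 => <-.
have K0f m u : K0 u -> K0 (f 0 u) -> K0 (f m u).
  move=> Ku Kfu q; have := comm_f_esq0 m q u.
  by rewrite !Ku Kfu !linear0 addr0 sub0r => /eqP; rewrite oppr_eq0 => /eqP.
pose K (u : W) := forall s, K0 (iter s (f 0) u).
have Kf0 u : K u -> K (f 0 u) by move=> Ku s; rewrite -iterSr; exact: Ku.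
have iterP s c x y : iter s (f 0) (c *: x + y) = c *: iter s (f 0) x + iter s (f 0) y.
  by elim: s => //= s ->; rewrite linearP.
have iter0 s : iter s (f 0) 0 = 0 by elim: s => //= s ->; rewrite linear0.
have Kf m u : K u -> K (f m u).
  move=> Ku s; have -> : iter s (f 0) (f m u) = f m (iter s (f 0) u).
    by elim: s => //= s ->; rewrite comm_ff.
  by apply: K0f; [exact: Ku | exact: (Ku s.+1)].
(* Moving h_m past a power of f_0 leaves terms f_m; moving e_m leaves terms h_m. *)
have Kh m u : K u -> K (h m u).
  move=> + s; elim: s u => [|s IH] u Ku /=; first exact: K0h (Ku 0%N).
  have -> : f 0 (iter s (f 0) (h m u)) =
      2 *: iter s (f 0) (f m u) + iter s (f 0) (h m (f 0 u)).
    by rewrite -iterP -iterS iterSr comm_hf addr0 addrC addrNK.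
  by apply: K0lin.2; [exact: Kf | exact: IH (Kf0 _ Ku)].
suff Kw : K w by exact: Kw 0%N n.
apply: (basic_ind (S := K)) => //.
- split=> [s|c x y Kx Ky s]; first by rewrite iter0; exact: K0lin.1.
  by rewrite iterP; apply: K0lin.2; [exact: Kx | exact: Ky].
- case=> [|s] q; first exact: esq_vac.
  by rewrite iterSr vac_f // iter0; exact: K0lin.1.
- move=> m u + s; elim: s u => [|s IH] u Ku /=; first exact: K0e (Ku 0%N).
  have -> : f 0 (iter s (f 0) (e m u)) =
      (-1) *: iter s (f 0) (h m u) + iter s (f 0) (e m (f 0 u)).
    by rewrite -iterP -iterS iterSr scaleN1r h_of_ef opprB addrNK.
  by apply: K0lin.2; [exact: Kh | exact: IH (Kf0 _ Ku)].
- move=> u Ku s q; have -> : iter s (f 0) (d u) = d (iter s (f 0) u).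
    by elim: s => //= s ->; rewrite comm_df scale0r addr0.
  by have := comm_d_esq q (iter s (f 0) u); rewrite !Ku linear0 scaler0 addr0 => <-.
Qed.

(** The mode form of :h(z)e(z): = e'(z). *)
Lemma nprod_eq n w : nprod n w = - (n + 1)%:~R *: e n w.
Proof.
have := comm_f_esq 0 n w; rewrite !esq_eq0 linear0 sub0r => /esym/eqP.
rewrite addr0 oppr_eq0 intrM -scalerA -scalerDr scaler_eq0 pnatr_eq0 /=.
by rewrite addr_eq0 scaleNr => /eqP.
Qed.

(** Each h_(-j) h_j contributes the pair of terms of :h(z)e(z): with indices
    j and -j, and h_0^2 the middle term together with one extra e_n. *)
Lemma virasoro0_e n w : virasoro B 0 (e n w) =
  e n (virasoro B 0 w) - n%:~R *: e n w.
Proof.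
have [N [kw kew]] := killed_above_ex2 w (e n w).
pose A := (N + `|n|)%N.
rewrite (@virasoro0_window w N A) ?(@virasoro0_window (e n w) N A) //; try lia.
have h00 : h 0 (h 0 (e n w)) = e n (h 0 (h 0 w)) + 4 *: (e n (h 0 w) + e n w).
  rewrite comm_he add0r linearD linearZ /= !comm_he add0r -!addrA; congr (_ + _).
  rewrite !scalerDr !scalerA addrA -scalerDl; congr (_ *: _ + _ *: _); ring.
have hh j : h (- j) (h j (e n w)) =
    e n (h (- j) (h j w)) + 2 *: (e (n - j) (h j w) + h (- j) (e (n + j) w)).
  rewrite comm_he linearD linearZ /= comm_he -addrA [j + n]addrC [- j + n]addrC.
  by rewrite scalerDr.
rewrite h00; under eq_bigr => k _ do rewrite hh scalerDr scalerA mulVf ?scale1r ?pnatr_eq0 //.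
rewrite big_split /= !scalerDr scalerA mulVf ?pnatr_eq0 // scale1r.
have := nprod_eq n w.
rewrite (@nprod_window n w N (- A%:Z) (2 * A).+1) //; try lia.
rewrite sum_reflect /nprod_term ltxx subr0.
have -> : \sum_(k < A)
     ((if 1 + k%:Z < 0 then h (1 + k%:Z) (e (n - (1 + k%:Z)) w)
       else e (n - (1 + k%:Z)) (h (1 + k%:Z) w)) +
      (if - (1 + k%:Z) < 0 then h (- (1 + k%:Z)) (e (n - - (1 + k%:Z)) w)
       else e (n - - (1 + k%:Z)) (h (- (1 + k%:Z)) w))) =
    \sum_(k < A) (e (n - (1 + k%:Z)) (h (1 + k%:Z) w) +
                  h (- (1 + k%:Z)) (e (n + (1 + k%:Z)) w)).
  apply: eq_bigr => k _; rewrite opprK.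
  have -> : (1 + k%:Z < 0) = false by lia.
  by have -> : - (1 + k%:Z) < 0 by lia.
move=> np; rewrite scalerA mulVf ?pnatr_eq0 // scale1r.
rewrite linearD linearZ linear_sum /= !addrA [LHS](ACl (1*4*((2*5)*3))) /= np.
rewrite -[X in _ + (_ + X)]scale1r -scalerDl -scaleNr; congr (_ + _ + _ *: _).
  by apply: eq_bigr => k _; rewrite linearZ.
by rewrite intrD opprD addrNK.
Qed.

Lemma virasoro0_d w : virasoro B 0 (d w) = d (virasoro B 0 w).
Proof.
have [N [kw kdw]] := killed_above_ex2 w (d w).
rewrite (@virasoro0_window w N N) // (@virasoro0_window (d w) N N) //.
rewrite linearD linearZ linear_sum /= comm_dh comm_dh !scale0r !addr0.
congr (_ + _); apply: eq_bigr => k _.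
rewrite linearZ comm_dh comm_dh linearD linearZ -addrA -scalerDl /=.
by rewrite mulrNz subrr scale0r addr0.
Qed.

Lemma virasoro0_linear c u v :
  virasoro B 0 (c *: u + v) = c *: virasoro B 0 u + virasoro B 0 v.
Proof.
have [N ku] := killed_above_ex u; have [P [kv kuv]] := killed_above_ex2 v (c *: u + v).
pose A := (N + P)%N.
rewrite (@virasoro0_window u N A) ?(@virasoro0_window v P A) //; try lia.
rewrite (@virasoro0_window _ P A kuv); last by lia.
have hP j x y : h j (c *: x + y) = c *: h j x + h j y by exact: linearP.
rewrite !hP [in RHS]scalerDr [in RHS]scaler_sumr addrACA -big_split; congr (_ + _).
  by rewrite scalerDr !scalerA mulrC.
by apply: eq_bigr => k _; rewrite !hP scalerDr !scalerA mulrC.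
Qed.

Lemma virasoro0_adj : adjoint_for form (virasoro B 0) (virasoro B 0).
Proof.
move=> u v; have [N [ku kv]] := killed_above_ex2 u v.
rewrite (@virasoro0_window u N N) // (@virasoro0_window v N N) //.
rewrite linearDl linearDr linear_sumlz linear_sumr; congr (_ + _).
  rewrite linearZl_LR linearZr_LR /= !adj_h oppr0; congr (_ * _).
  by rewrite fmorphV rmorph_nat.
apply: eq_bigr => k _; rewrite linearZl_LR linearZr_LR /= !adj_h opprK; congr (_ * _).
by rewrite fmorphV rmorph_nat.
Qed.

(** D = L_0 + d commutes with e_n by [virasoro0_e], with f_n by taking adjoints,
    and with h_n because h_n = [e_n, f_0]; its kernel is a submodule containing
    the vacuum. *)
Lemma virasoro0_eq w : virasoro B 0 w = - d w.
Proof.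
have Lvac : virasoro B 0 vac = 0.
  have k0 : killed_above 0 vac by move=> j j0; rewrite vac_e ?vac_f ?vac_h //; lia.
  by rewrite (@virasoro0_window vac 0 0) // big_ord0 vac_h // linear0 scaler0 addr0.
move: Lvac virasoro0_adj virasoro0_linear virasoro0_e virasoro0_d.
generalize (virasoro B 0) => L Lvac Ladj Llin Le Ld.
pose D (u : W) := L u + d u.
have De n u : D (e n u) = e n (D u).
  by rewrite /D Le comm_de addrACA addNr addr0 -linearD.
have Dadj : adjoint_for form D D.
  by move=> u v; rewrite /D linearDl linearDr; congr (_ + _); [exact: Ladj | exact: bas_d_adj].
(* [D, f_n] is minus the adjoint of [D, e_(-n)]. *)
have Df n u : D (f n u) = f n (D u).
  have formB x y z : form (x - y) z = form x z - form y z by exact: linearBl.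
  apply/eqP; rewrite -subr_eq0 -(dnorm_eq0 form); apply/eqP.
  by rewrite formB Dadj !adj_f -De Dadj subrr.
have Dlin c u v : D (c *: u + v) = c *: D u + D v.
  by rewrite /D Llin linearP scalerDr addrACA.
suff: D w = 0 by move/eqP; rewrite addr_eq0 => /eqP.
have D0 : D 0 = 0 by have := Dlin (-1) 0 0; rewrite scaler0 addr0 scaleN1r addNr.
apply: (basic_ind (S := fun u => D u = 0)) w => //.
- by split=> [//|c x y Dx Dy]; rewrite Dlin Dx Dy scaler0 addr0.
- by rewrite /D vac_d Lvac addr0.
- by move=> n u Du; rewrite De Du linear0.
- by move=> n u Du; rewrite Df Du linear0.
- move=> n u Du.
  by rewrite h_of_ef addrC -scaleN1r Dlin Df De De Df Du !linear0 addr0.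
- by move=> u; rewrite /D Ld -linearD => ->; rewrite linear0.
Qed.

End BasicModule.

(** * The stable major index *)

(** From some n on, passing from n to n+1 adds 2n+1 to both n^2 and the major
    index. *)
Lemma stable_maj_int (R : realType) k (t : filling) :
  Tk k t -> exists z : int, stable_maj R t = z%:~R.
Proof.
move=> [_ [l0 tl]]; pose n0 := (l0 + k).+1.
have row i : (2 * n0 <= i.+1)%N -> (t i).1 = odd i.
  move=> n0i; have [_ ->] := tl l0 (leqnn _); last by rewrite /n0 in n0i; lia.
  rewrite /tau_; have -> : (i <= 2 * k)%N = false by rewrite /n0 in n0i; lia.
  by case: odd.
pose u n : int := (n ^ 2)%:Z - (maj t (2 * n))%:Z.
have uS n : (n0 <= n)%N -> u n.+1 = u n.
  move=> n0n; rewrite /u /maj mulnS add2n [in LHS]big_mkcond.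
  rewrite big_nat_recr 1?big_nat_recr /=; try by rewrite /n0 in n0n; lia.
  rewrite !row; try lia.
  have -> : odd (2 * n) = false by lia.
  have -> : odd (2 * n).+1 by lia.
  rewrite addn0 -big_mkcond.
  have -> : (n.+1 ^ 2 = n ^ 2 + (2 * n).+1)%N by rewrite -addn1 sqrnD; lia.
  by rewrite !PoszD opprD addrACA subrr addr0.
have ucst n : (n0 <= n)%N -> u n = u n0.
  elim: n => [//|n IH]; rewrite leq_eqVlt => /predU1P[->//|n0n].
  by rewrite uS // IH.
exists (u n0); apply: lim_near_cst => //.
exists n0 => // n /= /ucst <-.
by rewrite /u intrB -!pmulrn.
Qed.

(** * Transport to the space of tableaux *)

Section Transport.
Variable R : realType.
Local Notation C := R[i].

Lemma sum_msupp (K : choiceType) (g : malg K C) (F : K -> C) (s : K) :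
  \sum_(x <- msupp g) (mcoeff x g * F x) *+ (x == s) = mcoeff s g * F s.
Proof.
have [sg|sg] := boolP (s \in msupp g).
  rewrite (bigD1_seq s) //= eqxx big1 ?addr0 // => x /negPf ->.
  by rewrite mulr0n.
rewrite mcoeff_outdom // mul0r big_seq big1 // => x xg.
by case: eqP xg => [->|_ _]; [rewrite (negPf sg) | rewrite mulr0n].
Qed.

Lemma eq_HPi_key k (i j : 'I_(2 * k).+1) (t s : Tk k) :
  (HPi_key i t == HPi_key j s) = (i == j) && (t == s).
Proof. by rewrite /HPi_key eq_Tagged. Qed.

Lemma mcoeff_tens k (u : 'rV[C]_(2 * k).+1) (v : HPik R k) i t :
  mcoeff (HPi_key i t) (tens u v) = u 0 i * mcoeff t v.
Proof.
rewrite /tens raddf_sum (bigD1 i) //= [X in _ + X]big1 ?addr0 => [|j ji].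
  transitivity (\sum_(s <- msupp v) (mcoeff s v * u 0 i) *+ (s == t)).
    rewrite raddf_sum; apply: eq_bigr => s _ /=.
    by rewrite mcoeffZ mcoeffU eq_HPi_key eqxx mulr_natr mulrC.
  by rewrite (sum_msupp v (fun=> u 0 i)) mulrC.
rewrite raddf_sum big1 //= => s _.
by rewrite mcoeffZ mcoeffU eq_HPi_key (negPf ji) mulr0n mulr0.
Qed.

(** This makes the transported operator unique. *)
Lemma tens_inj k (v w : HPik R k) :
  (forall u, tens u v = tens u w) -> v = w.
Proof.
move=> vw; apply/malgP => t.
have /(congr1 (mcoeff (HPi_key ord0 t))) := vw (delta_mx 0 ord0).
by rewrite !mcoeff_tens mxE !eqxx !mul1r.
Qed.

(** Candidates for the transported operator: those diagonal in the basis. *)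
Definition scale_basis (K : choiceType) (r : K -> C) (g : malg K C) : malg K C :=
  \sum_(x <- msupp g) (mcoeff x g * r x) *: basis_vec R x.

Lemma mcoeff_scale_basis (K : choiceType) (r : K -> C) g x :
  mcoeff x (scale_basis r g) = mcoeff x g * r x.
Proof.
rewrite /scale_basis raddf_sum -sum_msupp; apply: eq_bigr => y _ /=.
by rewrite mcoeffZ mcoeffU mulr_natr.
Qed.

Lemma tens_scale_basis k (r : Tk k -> C) (u : 'rV[C]_(2 * k).+1) (v : HPik R k) :
  tens u (scale_basis r v) =
  \sum_i \sum_(t <- msupp v)
    (u 0 i * mcoeff t v) *: (r t *: basis_vec R (HPi_key i t)).
Proof.
apply: eq_bigr => i _.
rewrite (big_fset_incl _ (B := msupp v)) /=.
- by apply: eq_bigr => t _; rewrite mcoeff_scale_basis mulrA scalerA.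
- apply/fsubsetP => t; rewrite -!mcoeff_neq0 mcoeff_scale_basis.
  by apply: contra_neq => ->; rewrite mul0r.
- by move=> t _; rewrite -mcoeff_eq0 => /eqP ->; rewrite mulr0 scale0r.
Qed.

Lemma scale_basis_vec (K : choiceType) (r : K -> C) x :
  scale_basis r (basis_vec R x) = r x *: basis_vec R x.
Proof.
apply/malgP => y; rewrite mcoeff_scale_basis mcoeffZ mcoeffU mulrC.
by case: eqP => [->|_] //; rewrite mulr0n !mulr0.
Qed.

End Transport.

Theorem corollary2 (R : realType) (W : lmodType R[i]) (B : basic_module W)
    (M : forall k : nat, unitary_irrep_sl2 R (2 * k).+1)
    (Psi : graded_unitary_iso B M) (k : nat) (tau : Tk k) :
  transported_virasoro Psi 0 (basis_vec R tau) =
  (stable_maj R (val tau))%:C%C *: basis_vec R tau.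
Proof.
pose r (t : Tk k) : R[i] := (stable_maj R (val t))%:C%C.
have inv_linear c x y :
    iso_inv Psi (c *: x + y) = c *: iso_inv Psi x + iso_inv Psi y.
  by apply: (can_inj (isoK Psi)); rewrite linearP !iso_invK.
pose P x := Psi (virasoro B 0 (iso_inv Psi x)).
have P_linear : linear P.
  by move=> c x y; rewrite /P !virasoro0_eq inv_linear !linearP.
pose Pl := GRing.isLinear.Build _ _ _ _ P P_linear.
pose PL : {linear HPi R -> HPi R} := HB.pack P Pl.
have Pkey i t : P (basis_vec R (HPi_key i t)) = r t *: basis_vec R (HPi_key i t).
  (* Only integers occur as degrees in the grading condition on Psi. *)
  have [z rz] := stable_maj_int R (set_mem (valP t)).
  have : deg_r z (basis_vec R (HPi_key i t)).
    move=> b; rewrite mcoeffU; case: (HPi_key i t =P b) => [<- _ //|_].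
    by rewrite mulr0n eqxx.
  rewrite -[X in deg_r _ X](iso_invK Psi) => /(iso_graded Psi z _).2.
  rewrite /P virasoro0_eq /deg_H => ->.
  by rewrite scaleNr opprK linearZ iso_invK /r rz rmorph_int.
pose S := [set T : HPik R k -> HPik R k |
  forall u v, Psi (virasoro B 0 (iso_inv Psi (tens u v))) = tens u (T v)]%classic.
have Sr : S (scale_basis r).
  move=> u v; rewrite tens_scale_basis -/(P (tens u v)) -[P]/(PL : _ -> _).
  rewrite /tens linear_sum; apply: eq_bigr => i _.
  rewrite linear_sum; apply: eq_bigr => t _.
  by rewrite linearZ; congr (_ *: _); exact: Pkey.
(* As S is inhabited, the default value of the operator is not taken. *)
have ST : S (transported_virasoro Psi 0).
  by rewrite /transported_virasoro; apply: xgetI Sr.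
rewrite -/(r tau) -scale_basis_vec; apply: tens_inj => u.
by rewrite -ST -Sr.
Qed.
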